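(* Let $\{X_j\}_{j\in\mathbb Z}$ be a zero-mean, weakly stationary, purely nondeterministic process with normalized innovations $\{\varepsilon_j\}_{j\in\mathbb Z}$, MA coefficients $\{b_k\}_{k\ge 0}$ and AR coefficients $\{a_k\}_{k\ge0}$. Let $m,n\ge 0$ be integers, $N=\{-m,\dots,n\}$, and for $j\ge -m$ let $\hat X_j$ be the linear least-squares predictor of $X_j$ based on the infinite past $\{X_k;k<-m\}$. Put $X'=(X_j-\hat X_j)_{j\in N}$, whose covariance matrix is $G=(g_{i,j})_{i,j\in N}$ with $g_{i,j}=\sum_{k=-m}^{\min(i,j)}b_{i-k}\overline{b_{j-k}}$. Then the entries $g^{i,j}$ of $G^{-1}$ and the components $Y_j$ of the dual $Y$ of $X'$ are given, for $i,j\in N$, by $$g^{i,j}=\sum_{k=\max(i,j)}^{n}\overline{a_{k-i}}\,a_{k-j},\qquad Y_j=\sum_{k=j}^{n}\overline{a_{k-j}}\,\varepsilon_k.$$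
   Context: All random variables are complex-valued, mean zero and in $L^2(\Omega,\mathcal F,P)$, with inner product $(U,V):=E[U\overline V]$ and norm $\lVert U\rVert:=E[|U|^2]^{1/2}$. The linear least-squares predictor of $X_j$ based on a family of variables is the orthogonal projection of $X_j$ onto the closed linear span of the family. For a purely nondeterministic weakly stationary process $\{X_j\}_{j\in\mathbb Z}$, the normalized innovations are $\varepsilon_j:=(X_j-P_jX_j)/\lVert X_j-P_jX_j\rVert$, where $P_j$ is the orthogonal projection onto $\overline{\mathrm{sp}}\{X_k;k<j\}$ (the denominators are positive). The MA coefficients are $b_k:=(X_0,\varepsilon_{-k})$, $k\ge0$. Pure nondeterminism means that the Wold decomposition reads $X_j=\sum_{k=-\infty}^{j}b_{j-k}\varepsilon_k$ for all $j\in\mathbb Z$ (mean-square convergent). The AR coefficients $\{a_k\}_{k\ge0}$ are the complex numbers defined by $\sum_{k=0}^{j}b_ka_{j-k}=\delta_{0j}$ for $j\ge0$. Dual: for a finite index set $N$ and a random vector $Z=(Z_j)_{j\in N}$ with zero-mean, square-integrable components, the dual of $Z$ is the (unique, if it exists) random vector $Y=(Y_j)_{j\in N}$ with $Y_j\in\mathrm{sp}\{Z_k;k\in N\}$ for all $j\in N$ and $(Z_i,Y_j)=\delta_{ij}$ for all $i,j\in N$. *)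

(* Defs.v *)
From HB Require Import structures.
From mathcomp Require Import all_boot all_order all_algebra.
From mathcomp Require Import all_classical all_reals all_analysis.
From mathcomp Require Export complex.
Set Implicit Arguments.
Unset Strict Implicit.
Unset Printing Implicit Defensive.
Import Order.TTheory GRing.Theory Num.Theory.
Import numFieldNormedType.Exports.
Local Open Scope classical_set_scope.
Local Open Scope ring_scope.

Section Hilbert.
Context (d : measure_display) (T : measurableType d) (R : realType).
Variable P : probability T R.
Local Notation C := (R[i]).

Definition cexpectation (U : T -> C) : C :=
  Complex (fine 'E_P[fun w => complex.Re (U w)])
          (fine 'E_P[fun w => complex.Im (U w)]).

Definition cinner (U V : T -> C) : C :=
  cexpectation (fun w => U w * (V w)^*%C).

Definition cnorm (U : T -> C) : R :=
  Num.sqrt (fine 'E_P[fun w => (Normc.normc (U w) ^+ 2)%R]).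

(* Centered square-integrable complex random variables. Elements are actual
   functions; equality in L^2 is equality [%[ae P]]. *)
Definition L2_0 (U : T -> C) : Prop :=
  [/\ measurable_fun setT (fun w => complex.Re (U w)),
      measurable_fun setT (fun w => complex.Im (U w)),
      ('E_P[fun w => (Normc.normc (U w) ^+ 2)%R] < +oo)%E &
      cexpectation U = 0].

Definition sp (S : set (T -> C)) (U : T -> C) : Prop :=
  L2_0 U /\ exists (n : nat) (c : 'I_n -> C) (Z : 'I_n -> T -> C),
    (forall i, S (Z i)) /\
    {ae P, forall w, U w = \sum_(i < n) c i * Z i w}.

Definition csp (S : set (T -> C)) (U : T -> C) : Prop :=
  L2_0 U /\ forall e : R, 0 < e ->
    exists V, sp S V /\ cnorm (fun w => U w - V w) < e.

(* [V] is a version of the orthogonal projection of [U] onto [csp S]. *)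
Definition is_proj (S : set (T -> C)) (U V : T -> C) : Prop :=
  csp S V /\ forall W, csp S W -> cinner (fun w => U w - V w) W = 0.

Definition is_dual (I : finType) (Z Y : I -> T -> C) : Prop :=
  (forall j, sp (range Z) (Y j)) /\
  (forall i j, cinner (Z i) (Y j) = (i == j)%:R).

(* For centered [Z], so no mean is subtracted. *)
Definition covmx (n : nat) (Z : 'I_n -> T -> C) : 'M[C]_n :=
  \matrix_(i, j) cinner (Z i) (Z j).

Definition past (X : int -> T -> C) (j : int) : set (T -> C) :=
  [set X k | k in [set k : int | k < j]].

Definition weakly_stationary (X : int -> T -> C) : Prop :=
  (forall j, L2_0 (X j)) /\
  (forall j k l, cinner (X (j + l)) (X (k + l)) = cinner (X j) (X k)).

Definition normalized_innovations (X eps : int -> T -> C) : Prop :=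
  forall j, L2_0 (eps j) /\ exists PX : T -> C,
    let err := fun w => X j w - PX w in
    [/\ is_proj (past X j) (X j) PX, 0 < cnorm err &
        {ae P, forall w, eps j w = err w / (real_complex R (cnorm err))}].

Definition MA_coef (X eps : int -> T -> C) (k : nat) : C :=
  cinner (X 0) (eps (- k%:Z)).

(* The Wold decomposition has no deterministic part. The partial sums are
   written with l = j - k, which runs over 0, 1, 2, and so on. *)
Definition purely_nondeterministic (X : int -> T -> C) : Prop :=
  exists eps : int -> T -> C, normalized_innovations X eps /\
    forall j : int,
      (fun N : nat => cnorm (fun w =>
         X j w - \sum_(l < N) MA_coef X eps l * eps (j - l%:Z) w))
      @ \oo --> (0 : R).

End Hilbert.

Definition AR_coef (R : realType) (b a : nat -> R[i]) : Prop :=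
  forall j : nat, \sum_(k < j.+1) b k * a (j - k)%N = (j == 0%N)%:R.

(* The index set {-m, ..., n} is encoded by 'I_(m + n).+1, the ordinal i
   standing for the integer i - m. Differences of indices are unaffected by
   this shift, and a sum over k from max(i,j) to n becomes a sum over the
   ordinals k >= max(i,j). *)
Definition idx (m i : nat) : int := i%:Z - m%:Z.

Definition pred_error (T : Type) (R : realType) (m n : nat)
    (X hatX : int -> T -> R[i]) : 'I_(m + n).+1 -> T -> R[i] :=
  fun i w => X (idx m i) w - hatX (idx m i) w.

Arguments pred_error {T R} m n X hatX.

(* Main.v *)
Require Import Defs.
From mathcomp Require Import all_boot all_order all_algebra.
From mathcomp Require Import all_classical all_reals all_analysis.
From mathcomp Require Import measurable_realfun zify ring lra.
Set Implicit Arguments.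
Unset Strict Implicit.
Unset Printing Implicit Defensive.
Import Order.TTheory GRing.Theory Num.Theory.
Import numFieldNormedType.Exports.
Local Open Scope classical_set_scope.
Local Open Scope ring_scope.

(** The innovations are orthonormal, so everything reduces to identities between
    lower triangular Toeplitz matrices once one knows the expansion
    [X_j - hatX_j = \sum_(k = -m)^j b_(j-k) eps_k]. For the latter, let [D] be
    the difference of the two sides: [D] is orthogonal to the closed span of
    [{X_k; k < -m}] because each term is, and it belongs to that span because,
    by the Wold decomposition, [X_j] minus the right-hand side is a limit of
    combinations of the [eps_k] with [k < -m]; hence [D = 0] almost everywhere.
    With [B], [A] the Toeplitz matrices of [b] and [a], this reads [X' = B eps],
    and the definition of the AR coefficients is [B A = 1]. Therefore
    [G = B B^*], [G^-1 = A^* A], and [A^* eps = G^-1 X'] is the dual of [X']. *)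

(** * Complex random variables: integrability, expectation, inner product *)

Section ComplexRandomVariables.
Context (d : measure_display) (T : measurableType d) (R : realType).
Variable P : probability T R.
Local Notation C := (R[i]).
Local Notation Re := (@complex.Re R).
Local Notation Im := (@complex.Im R).
Local Notation normsq x := (Normc.normc x ^+ 2).
Implicit Types U V W : T -> C.
Local Arguments cexpectation : simpl never.
Local Arguments cinner : simpl never.

Lemma normc_sq (x : C) : normsq x = Re x ^+ 2 + Im x ^+ 2.
Proof. by case: x => x y; rewrite /= sqr_sqrtr// addr_ge0 ?sqr_ge0. Qed.

Lemma ReD (x y : C) : Re (x + y) = Re x + Re y.
Proof. by case: x y => ? ? []. Qed.

Lemma ImD (x y : C) : Im (x + y) = Im x + Im y.
Proof. by case: x y => ? ? []. Qed.

Lemma ReM (x y : C) : Re (x * y) = Re x * Re y - Im x * Im y.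
Proof. by case: x y => ? ? []. Qed.

Lemma ImM (x y : C) : Im (x * y) = Re x * Im y + Im x * Re y.
Proof. by case: x y => ? ? []. Qed.

Lemma Re_conj (x : C) : Re x^*%C = Re x.
Proof. by case: x. Qed.

Lemma Im_conj (x : C) : Im x^*%C = - Im x.
Proof. by case: x. Qed.

Lemma cexpectationE U :
  cexpectation P U = Complex (\int[P]_w Re (U w)) (\int[P]_w Im (U w)).
Proof. by rewrite /cexpectation unlock. Qed.

Definition cintegrable U : Prop :=
  P.-integrable setT (EFin \o (fun w => Re (U w))) /\
  P.-integrable setT (EFin \o (fun w => Im (U w))).

(** The real and imaginary parts of a product [c * U] have the shape [r * f + s * g] in the two
    parts of [U], hence the two scalars. *)
Lemma integrable_lin (r s : R) (f g : T -> R) :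
  P.-integrable setT (EFin \o f) -> P.-integrable setT (EFin \o g) ->
  P.-integrable setT (EFin \o (fun w => r * f w + s * g w)).
Proof.
move=> fi gi; rewrite (_ : _ \o _ = (fun w => r%:E * (EFin \o f) w)%E \+
    (fun w => s%:E * (EFin \o g) w)%E)%E; last exact: funext.
by apply: integrableD => //; apply: integrableZl.
Qed.

Lemma Rintegral_lin (r s : R) (f g : T -> R) :
  P.-integrable setT (EFin \o f) -> P.-integrable setT (EFin \o g) ->
  \int[P]_w (r * f w + s * g w) = r * (\int[P]_w f w) + s * \int[P]_w g w.
Proof.
move=> fi gi; rewrite RintegralD ?RintegralZl//.
- exact: (integrableZl _ r fi).
- exact: (integrableZl _ s gi).
Qed.

Lemma cexpectation_lin c U V : cintegrable U -> cintegrable V ->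
  cexpectation P (fun w => c * U w + V w) =
  c * cexpectation P U + cexpectation P V.
Proof.
move=> [Ur Ui] [Vr Vi]; rewrite !cexpectationE; apply/eqP.
rewrite eq_complex; apply/andP; split; apply/eqP; rewrite ?ReD ?ImD ?ReM ?ImM /=.
- under eq_Rintegral => w _ do
    rewrite ReD ReM -[Re (V w)]mul1r -[X in X + _]mul1r -mulNr.
  by rewrite !Rintegral_lin//; [ring|exact: integrable_lin].
- under eq_Rintegral => w _ do
    rewrite ImD ImM addrC -[Im (V w)]mul1r -[X in _ + X]mul1r.
  by rewrite !Rintegral_lin//; [ring|exact: integrable_lin].
Qed.

Lemma cexpectation_conj U : cintegrable U ->
  cexpectation P (fun w => (U w)^*%C) = (cexpectation P U)^*%C.
Proof.
move=> [Ur Ui]; rewrite !cexpectationE /=.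
under eq_Rintegral => w _ do rewrite Re_conj.
under [X in Complex _ X]eq_Rintegral => w _ do rewrite Im_conj -mulN1r.
by rewrite RintegralZl// mulN1r.
Qed.

(** [L2_0] without the centering, so that nonzero constants qualify as well. *)
Definition sqintegrable U : Prop :=
  [/\ measurable_fun setT (fun w => Re (U w)),
      measurable_fun setT (fun w => Im (U w)) &
      P.-integrable setT (EFin \o (fun w => normsq (U w)))].

Lemma measurable_normsq U : measurable_fun setT (fun w => Re (U w)) ->
  measurable_fun setT (fun w => Im (U w)) ->
  measurable_fun setT (fun w => normsq (U w)).
Proof.
move=> mr mi; under eq_fun do rewrite normc_sq.
by apply: measurable_funD; apply: measurable_funX.
Qed.

Lemma L2_0E U : L2_0 P U <-> sqintegrable U /\ cexpectation P U = 0.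
Proof.
rewrite /L2_0 unlock; split.
- move=> [mr mi Ufin U0]; split=> //; split=> //; apply/integrableP; split.
    by apply/measurable_EFinP; exact: measurable_normsq.
  by under eq_integral do rewrite gee0_abs ?lee_fin ?sqr_ge0//.
- move=> [[mr mi /integrableP[_ Ufin]] U0]; split=> //.
  apply: le_lt_trans Ufin; apply: ge0_le_integral => //.
  + by move=> w _; rewrite lee_fin sqr_ge0.
  + by apply/measurable_EFinP; exact: measurable_normsq.
  + by apply/measurable_EFinP; apply: measurableT_comp => //;
      exact: measurable_normsq.
  + by move=> w _; rewrite lee_fin ler_norm.
Qed.

Lemma L2_0_sqintegrable U : L2_0 P U -> sqintegrable U.
Proof. by rewrite L2_0E => -[]. Qed.

(** Domination criterion shared by squared norms of combinations and by the two parts of a product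
    [U * conj V]. *)
Lemma integrable_normsq_bound (f : T -> R) U V (r : R) :
  sqintegrable U -> sqintegrable V -> measurable_fun setT f ->
  (forall w, `|f w| <= r * (normsq (U w) + normsq (V w))) ->
  P.-integrable setT (EFin \o f).
Proof.
move=> [_ _ Ui] [_ _ Vi] mf fle.
apply: (@le_integrable _ _ _ _ _ _ _ (EFin \o (fun w =>
  r * normsq (U w) + r * normsq (V w)))) => //; last exact: integrable_lin.
- exact/measurable_EFinP.
- move=> w _; rewrite /= lee_fin (le_trans (fle w))// mulrDr ler_norm //.
Qed.

Lemma sqintegrable_cst c : sqintegrable (fun=> c).
Proof.
by split=> //; apply: finite_measure_integrable_cst.
Qed.

Lemma sqintegrable_lin c U V : sqintegrable U -> sqintegrable V ->
  sqintegrable (fun w => c * U w + V w).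
Proof.
move=> hU hV; have [Ur Ui _] := hU; have [Vr Vi _] := hV.
have mr : measurable_fun setT (fun w => Re (c * U w + V w)).
  under eq_fun do rewrite ReD ReM.
  apply: measurable_funD => //; apply: measurable_funB;
  exact: measurable_funM.
have mi : measurable_fun setT (fun w => Im (c * U w + V w)).
  under eq_fun do rewrite ImD ImM.
  apply: measurable_funD => //; apply: measurable_funD;
  exact: measurable_funM.
split=> //.
(* The constant comes from |cU + V|^2 <= 2|c|^2|U|^2 + 2|V|^2, which is at most (2|c|^2 + 2)(|U|^2 +
   |V|^2). *)
apply: (@integrable_normsq_bound _ U V (2 * normsq c + 2)) => //.
  exact: measurable_normsq.
move=> w; rewrite ger0_norm ?sqr_ge0// !normc_sq !ReD !ImD !ReM !ImM.
have le2 (x y : R) : (x + y) ^+ 2 <= 2 * x ^+ 2 + 2 * y ^+ 2.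
  by have := sqr_ge0 (x - y); rewrite sqrrB sqrrD; lra.
apply: le_trans (lerD (le2 _ _) (le2 _ _)) _.
move: (Re c) (Im c) (Re (U w)) (Im (U w)) (Re (V w)) (Im (V w)) => x y u v s t.
rewrite -subr_ge0 [leRHS](_ : _ = 2 * (u ^+ 2 + v ^+ 2) +
  2 * (x ^+ 2 + y ^+ 2) * (s ^+ 2 + t ^+ 2)); last by ring.
by rewrite addr_ge0// !mulr_ge0// addr_ge0// sqr_ge0.
Qed.

Lemma cintegrable_mul U V : sqintegrable U -> sqintegrable V ->
  cintegrable (fun w => U w * (V w)^*%C).
Proof.
move=> hU hV; have [Ur Ui _] := hU; have [Vr Vi _] := hV; split.
- apply: (@integrable_normsq_bound _ U V 1) => //.
    under eq_fun do rewrite ReM Re_conj Im_conj mulrN.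
    by apply: measurable_funB; [|apply: measurableT_comp => //];
      apply: measurable_funM.
  move=> w; rewrite mul1r !normc_sq ReM Re_conj Im_conj ler_norml.
  move: (Re (U w)) (Im (U w)) (Re (V w)) (Im (V w)) => u v s t.
  (* Arithmetic-geometric mean inequality for [u * s] and [v * t], in both signs because of the
     absolute value. *)
  have := sqr_ge0 (u - s); have := sqr_ge0 (u + s).
  have := sqr_ge0 (v - t); have := sqr_ge0 (v + t).
  have := sqr_ge0 u; have := sqr_ge0 v; have := sqr_ge0 s; have := sqr_ge0 t.
  by rewrite !(sqrrB, sqrrD); lra.
- apply: (@integrable_normsq_bound _ U V 1) => //.
    under eq_fun do rewrite ImM Re_conj Im_conj.
    apply: measurable_funD; apply: measurable_funM => //.
    exact: measurableT_comp.
  move=> w; rewrite mul1r !normc_sq ImM Re_conj Im_conj ler_norml.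
  move: (Re (U w)) (Im (U w)) (Re (V w)) (Im (V w)) => u v s t.
  have := sqr_ge0 (u - t); have := sqr_ge0 (u + t).
  have := sqr_ge0 (v - s); have := sqr_ge0 (v + s).
  have := sqr_ge0 u; have := sqr_ge0 v; have := sqr_ge0 s; have := sqr_ge0 t.
  by rewrite !(sqrrB, sqrrD); lra.
Qed.

(** A probability measure is finite, so the constant 1 is square-integrable and [U] is the product
    of [U] with it. *)
Lemma sqintegrable_cintegrable U : sqintegrable U -> cintegrable U.
Proof.
move=> hU; have := cintegrable_mul hU (sqintegrable_cst 1).
by under [X in cintegrable X]eq_fun do rewrite conjc1 mulr1.
Qed.

Lemma L2_0_lin c U V : L2_0 P U -> L2_0 P V ->
  L2_0 P (fun w => c * U w + V w).
Proof.
rewrite !L2_0E => -[hU U0] [hV V0]; split; first exact: sqintegrable_lin.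
by rewrite cexpectation_lin ?U0 ?V0 ?mulr0 ?addr0//;
  exact: sqintegrable_cintegrable.
Qed.

Lemma L2_00 : L2_0 P (fun=> 0).
Proof.
apply/L2_0E; split; first exact: sqintegrable_cst.
rewrite cexpectationE; apply/eqP; rewrite eq_complex /=.
by rewrite /Rintegral integral0 eqxx.
Qed.

Lemma L2_0D U V : L2_0 P U -> L2_0 P V -> L2_0 P (fun w => U w + V w).
Proof.
by move=> /(L2_0_lin 1)/[apply]; under eq_fun do rewrite mul1r.
Qed.

Lemma L2_0Z c U : L2_0 P U -> L2_0 P (fun w => c * U w).
Proof.
by move=> /(L2_0_lin c)/(_ L2_00); under eq_fun do rewrite addr0.
Qed.

Lemma L2_0B U V : L2_0 P U -> L2_0 P V -> L2_0 P (fun w => U w - V w).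
Proof.
move=> hU /(L2_0Z (-1)) hV; have := L2_0D hU hV.
by under eq_fun do rewrite mulN1r.
Qed.

Lemma L2_0_sum (I : Type) (r : seq I) (Q : pred I) (c : I -> C)
    (F : I -> T -> C) : (forall i, L2_0 P (F i)) ->
  L2_0 P (fun w => \sum_(i <- r | Q i) c i * F i w).
Proof.
move=> hF; elim: r => [|i r IHr].
  by under eq_fun do rewrite big_nil; exact: L2_00.
under eq_fun do rewrite big_cons.
by case: (Q i) => //; apply: L2_0_lin.
Qed.

(** * Sesquilinearity and definiteness of the inner product *)

Lemma cinner_lin c U V W : L2_0 P U -> L2_0 P V -> L2_0 P W ->
  cinner P (fun w => c * U w + V w) W = c * cinner P U W + cinner P V W.
Proof.
move=> /L2_0_sqintegrable hU /L2_0_sqintegrable hV /L2_0_sqintegrable hW.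
rewrite /cinner -cexpectation_lin; [|exact: cintegrable_mul..].
by congr cexpectation; apply/funext => w; rewrite mulrDl mulrA.
Qed.

Lemma cinner_conj U V : L2_0 P U -> L2_0 P V ->
  cinner P U V = (cinner P V U)^*%C.
Proof.
move=> /L2_0_sqintegrable hU /L2_0_sqintegrable hV.
rewrite /cinner -cexpectation_conj; last exact: cintegrable_mul.
by congr cexpectation; apply/funext => w; rewrite rmorphM/= conjcK mulrC.
Qed.

Lemma cinner0l W : cinner P (fun=> 0) W = 0.
Proof.
have /L2_0E[_ E0] := L2_00; rewrite -[RHS]E0 /cinner.
by congr cexpectation; apply/funext => w; rewrite mul0r.
Qed.

Lemma cinnerDl U V W : L2_0 P U -> L2_0 P V -> L2_0 P W ->
  cinner P (fun w => U w + V w) W = cinner P U W + cinner P V W.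
Proof.
move=> hU hV hW; have := cinner_lin 1 hU hV hW.
by under eq_fun do rewrite mul1r; rewrite mul1r.
Qed.

Lemma cinnerZl c U W : L2_0 P U -> L2_0 P W ->
  cinner P (fun w => c * U w) W = c * cinner P U W.
Proof.
move=> hU hW; have := cinner_lin c hU L2_00 hW.
by under eq_fun do rewrite addr0; rewrite cinner0l addr0.
Qed.

Lemma cinnerBl U V W : L2_0 P U -> L2_0 P V -> L2_0 P W ->
  cinner P (fun w => U w - V w) W = cinner P U W - cinner P V W.
Proof.
move=> hU hV hW; rewrite -mulN1r -cinnerZl// -cinnerDl//; last exact: L2_0Z.
by congr cinner; apply/funext => w; rewrite mulN1r.
Qed.

Lemma cinner_suml (I : Type) (r : seq I) (Q : pred I) (c : I -> C)
    (F : I -> T -> C) W : (forall i, L2_0 P (F i)) -> L2_0 P W ->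
  cinner P (fun w => \sum_(i <- r | Q i) c i * F i w) W =
  \sum_(i <- r | Q i) c i * cinner P (F i) W.
Proof.
move=> hF hW; elim: r => [|i r IHr].
  by under eq_fun do rewrite big_nil; rewrite big_nil cinner0l.
under eq_fun do rewrite big_cons; rewrite big_cons.
by case: (Q i) => //; rewrite cinner_lin ?IHr//; exact: L2_0_sum.
Qed.

Lemma cinnerDr U V W : L2_0 P U -> L2_0 P V -> L2_0 P W ->
  cinner P W (fun w => U w + V w) = cinner P W U + cinner P W V.
Proof.
move=> hU hV hW; rewrite cinner_conj ?cinnerDl//; last exact: L2_0D.
by rewrite (cinner_conj hW hU) (cinner_conj hW hV) rmorphD.
Qed.

Lemma cinnerZr c U W : L2_0 P U -> L2_0 P W ->
  cinner P W (fun w => c * U w) = c^*%C * cinner P W U.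
Proof.
move=> hU hW; rewrite cinner_conj ?cinnerZl//; last exact: L2_0Z.
by rewrite (cinner_conj hW hU) rmorphM.
Qed.

Lemma cinnerBr U V W : L2_0 P U -> L2_0 P V -> L2_0 P W ->
  cinner P W (fun w => U w - V w) = cinner P W U - cinner P W V.
Proof.
move=> hU hV hW; rewrite cinner_conj ?cinnerBl//; last exact: L2_0B.
by rewrite (cinner_conj hW hU) (cinner_conj hW hV) rmorphB.
Qed.

Lemma cinner_sumr (I : Type) (r : seq I) (Q : pred I) (c : I -> C)
    (F : I -> T -> C) W : (forall i, L2_0 P (F i)) -> L2_0 P W ->
  cinner P W (fun w => \sum_(i <- r | Q i) c i * F i w) =
  \sum_(i <- r | Q i) (c i)^*%C * cinner P W (F i).
Proof.
move=> hF hW; rewrite cinner_conj ?cinner_suml//; last exact: L2_0_sum.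
rewrite rmorph_sum; apply: eq_bigr => i _ /=.
by rewrite (cinner_conj hW (hF i)) rmorphM.
Qed.

Lemma cinner_ae U U' V V' : L2_0 P U -> L2_0 P U' -> L2_0 P V -> L2_0 P V' ->
  {ae P, forall w, U w = U' w} -> {ae P, forall w, V w = V' w} ->
  cinner P U V = cinner P U' V'.
Proof.
move=> /L2_0_sqintegrable hU /L2_0_sqintegrable hU'.
move=> /L2_0_sqintegrable hV /L2_0_sqintegrable hV' eU eV.
have [/integrableP[r1 _] /integrableP[i1 _]] := cintegrable_mul hU hV.
have [/integrableP[r2 _] /integrableP[i2 _]] := cintegrable_mul hU' hV'.
rewrite /cinner !cexpectationE /Rintegral.
congr (Complex (fine _) (fine _)); apply: ae_eq_integral => //;
  by apply: filterS2 eU eV => w -> ->.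
Qed.

Lemma cnorm_sq U : L2_0 P U -> real_complex R (cnorm P U ^+ 2) = cinner P U U.
Proof.
move=> hU; rewrite /cnorm /cinner cexpectationE unlock.
rewrite sqr_sqrtr; last first.
  by apply: fine_ge0; apply: integral_ge0 => w _; rewrite lee_fin sqr_ge0.
apply/eqP; rewrite eq_complex /=; apply/andP; split; apply/eqP.
- apply: eq_Rintegral => w _.
  by rewrite normc_sq ReM Re_conj Im_conj; ring.
- under eq_Rintegral => w _ do
    rewrite ImM Re_conj Im_conj mulrN mulrC addNr.
  by rewrite /Rintegral integral0.
Qed.

Lemma cnorm_ge0 U : 0 <= cnorm P U.
Proof. exact: sqrtr_ge0. Qed.

Lemma cinner_self_eq0 U : L2_0 P U -> cinner P U U = 0 ->
  {ae P, forall w, U w = 0}.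
Proof.
move=> hU; have [mr mi /integrableP[mU Ui]] := L2_0_sqintegrable hU.
rewrite -cnorm_sq// => -[]; rewrite /cnorm unlock sqr_sqrtr; last first.
  by apply: fine_ge0; apply: integral_ge0 => w _; rewrite lee_fin sqr_ge0.
move=> int0.
have abs_int : (\int[P]_w (normsq (U w))%:E =
    \int[P]_w `|(EFin \o (fun w => normsq (U w))) w|)%E.
  by apply: eq_integral => w _; rewrite gee0_abs// lee_fin sqr_ge0.
(* [fine] also sends an infinite value to 0, so finiteness of the integral is what lifts [int0] to
   the extended reals. *)
have : (\int[P]_w `|(EFin \o (fun w => normsq (U w))) w| = 0)%E.
  rewrite -abs_int -[LHS]fineK ?int0// abs_int ge0_fin_numE//.
  exact: integral_ge0.
move/(ae_eq_integral_abs _ measurableT mU); apply: filterS => w /(_ I) [].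
by move/eqP; rewrite sqrf_eq0 => /eqP /Normc.eq0_normc.
Qed.

End ComplexRandomVariables.

(** * Norm estimates, spans and closed spans, uniqueness of projections and duals *)

Section ClosedSpan.
Context (d : measure_display) (T : measurableType d) (R : realType).
Variable P : probability T R.
Local Notation C := (R[i]).
Implicit Types (U V W : T -> C) (S : set (T -> C)).
Local Arguments cinner : simpl never.

Lemma cnorm_ae U V : L2_0 P U -> L2_0 P V ->
  {ae P, forall w, U w = V w} -> cnorm P U = cnorm P V.
Proof.
move=> hU hV UV; have := cinner_ae hU hV hU hV UV UV.
by rewrite -!cnorm_sq// => -[] /eqP; rewrite eqrXn2 ?cnorm_ge0// => /eqP.
Qed.

Lemma cnorm0 : cnorm P (fun=> 0) = 0.
Proof.
have := cnorm_sq (L2_00 P); rewrite cinner0l => -[] /eqP.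
by rewrite sqrf_eq0 => /eqP.
Qed.

Lemma cnormZ c U : L2_0 P U ->
  cnorm P (fun w => c * U w) = Normc.normc c * cnorm P U.
Proof.
move=> hU; apply/eqP; rewrite -(@eqrXn2 _ 2%N) ?cnorm_ge0//; last first.
  by rewrite mulr_ge0 ?cnorm_ge0//; case: c => x y; exact: sqrtr_ge0.
apply/eqP/(@complexI R); rewrite exprMn [RHS]rmorphM/= !cnorm_sq//; last exact: L2_0Z.
rewrite cinnerZl ?cinnerZr//; last exact: L2_0Z.
rewrite mulrA; congr (_ * _).
by rewrite normc_sq; case: c => x y; apply/eqP; rewrite eq_complex /=;
  apply/andP; split; apply/eqP; ring.
Qed.

Lemma cnorm_parallelogram U V : L2_0 P U -> L2_0 P V ->
  cnorm P (fun w => U w + V w) ^+ 2 + cnorm P (fun w => U w - V w) ^+ 2 =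
  (cnorm P U ^+ 2 + cnorm P V ^+ 2) *+ 2.
Proof.
move=> hU hV; have hD := L2_0D hU hV; have hB := L2_0B hU hV.
apply: (@complexI R); rewrite rmorphMn/= !rmorphD/= !cnorm_sq//.
rewrite cinnerDl// cinnerBl// !(cinnerDr hU hV)// !(cinnerBr hU hV)//; ring.
Qed.

(** Serves as the triangle inequality in approximation arguments: dropping the difference term of
    the parallelogram law leaves ||U + V||^2 <= 2(||U||^2 + ||V||^2) < e^2. *)
Lemma cnormD_lt (e : R) U V : L2_0 P U -> L2_0 P V ->
  cnorm P U < e / 2 -> cnorm P V < e / 2 ->
  cnorm P (fun w => U w + V w) < e.
Proof.
move=> hU hV Ue Ve; have e0 : 0 < e / 2 := le_lt_trans (cnorm_ge0 P U) Ue.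
rewrite -(@ltr_pXn2r _ 2%N) ?nnegrE ?cnorm_ge0//; last by lra.
have := cnorm_parallelogram hU hV.
have := sqr_ge0 (cnorm P (fun w => U w - V w)).
have : cnorm P U ^+ 2 < (e / 2) ^+ 2.
  by rewrite ltr_pXn2r ?nnegrE ?cnorm_ge0// ltW.
have : cnorm P V ^+ 2 < (e / 2) ^+ 2.
  by rewrite ltr_pXn2r ?nnegrE ?cnorm_ge0// ltW.
have -> : (e / 2) ^+ 2 = e ^+ 2 / 4 by field.
lra.
Qed.

Lemma sp_gen S U : L2_0 P U -> S U -> sp P S U.
Proof.
move=> hU SU; split=> //; exists 1, (fun=> 1), (fun=> U); split=> //.
by apply: aeW => w; rewrite big_ord1 mul1r.
Qed.

Lemma sp0 S : sp P S (fun=> 0).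
Proof.
split; first exact: L2_00.
exists 0, (fun=> 0), (fun _ _ => 0); split; first by case.
by apply: aeW => w; rewrite big_ord0.
Qed.

Lemma sp_lin S c U V : sp P S U -> sp P S V ->
  sp P S (fun w => c * U w + V w).
Proof.
move=> [hU [n1 [c1 [Z1 [SZ1 UE]]]]] [hV [n2 [c2 [Z2 [SZ2 VE]]]]].
split; first exact: L2_0_lin.
exists (n1 + n2)%N, (fun i : 'I_(n1 + n2) => match fintype.split i with
    | inl j => c * c1 j | inr j => c2 j end),
  (fun i : 'I_(n1 + n2) => match fintype.split i with
    | inl j => Z1 j | inr j => Z2 j end).
split; first by move=> i; case: (fintype.split i).
apply: filterS2 UE VE => w -> ->; rewrite big_split_ord /= mulr_sumr.
congr (_ + _); apply: eq_bigr => i _.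
- by rewrite (unsplitK (inl i)) mulrA.
- by rewrite (unsplitK (inr i)).
Qed.

Lemma spB S U V : sp P S U -> sp P S V -> sp P S (fun w => U w - V w).
Proof.
move=> hU hV; have := sp_lin (-1) hV hU.
by under eq_fun do rewrite mulN1r addrC.
Qed.

Lemma sp_csp S U : sp P S U -> csp P S U.
Proof.
move=> hU; split=> [|e e0]; first by case: hU.
exists U; split=> //; under [X in cnorm _ X]eq_fun do rewrite subrr.
by rewrite cnorm0.
Qed.

Lemma csp_L2_0 S U : csp P S U -> L2_0 P U. Proof. by case. Qed.

Lemma csp_gen S U : L2_0 P U -> S U -> csp P S U.
Proof. by move=> hU SU; apply/sp_csp/sp_gen. Qed.

Lemma csp_sub S S' U : S `<=` S' -> csp P S U -> csp P S' U.
Proof.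
move=> SS' [hU hap]; split=> // e /hap[V [[hV [n [c [Z [SZ VE]]]]] UV]].
exists V; split=> //; split=> //; exists n, c, Z; split=> // i.
exact: SS'.
Qed.

(** An [e / 2] approximant [V] in the closed span has itself an [e / 2] approximant in the span. *)
Lemma csp_closed S U : L2_0 P U ->
  (forall e : R, 0 < e ->
    exists V, csp P S V /\ cnorm P (fun w => U w - V w) < e) ->
  csp P S U.
Proof.
move=> hU hap; split=> // e e0; have e20 : 0 < e / 2 by lra.
have [V [[hV Vap] UV]] := hap _ e20.
have [W [[hW SW] VW]] := Vap _ e20.
exists W; split; first by split.
rewrite (_ : (fun w => _) = (fun w => (U w - V w) + (V w - W w))).
  by apply: cnormD_lt => //; exact: L2_0B.
by apply/funext => w; rewrite addrA subrK.
Qed.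

Lemma csp_ae S U V : csp P S U -> L2_0 P V ->
  {ae P, forall w, U w = V w} -> csp P S V.
Proof.
move=> hU hV UV; apply: csp_closed => // e e0; exists U; split=> //.
rewrite (@cnorm_ae _ (fun=> 0)) ?cnorm0//.
- exact: L2_0B hV (csp_L2_0 hU).
- exact: L2_00.
- by apply: filterS UV => w ->; rewrite subrr.
Qed.

Lemma csp_lin S c U V : csp P S U -> csp P S V ->
  csp P S (fun w => c * U w + V w).
Proof.
move=> [hU Uap] [hV Vap]; split; first exact: L2_0_lin.
move=> e e0; have c0 : 0 <= Normc.normc c by case: c => ? ?; exact: sqrtr_ge0.
(* The summand 1 keeps the divisor positive when [c = 0]. *)
have [|U' [spU' UU']] := Uap (e / 2 / (Normc.normc c + 1)).
  by rewrite !divr_gt0//; lra.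
have [|V' [spV' VV']] := Vap (e / 2); first by lra.
exists (fun w => c * U' w + V' w); split; first exact: sp_lin.
have [hU' _] := spU'; have [hV' _] := spV'.
rewrite (_ : (fun w => _) = (fun w => c * (U w - U' w) + (V w - V' w))).
  apply: cnormD_lt => //; [by apply/L2_0Z/L2_0B|exact: L2_0B|].
  rewrite cnormZ; last exact: L2_0B.
  move: UU'; rewrite ltr_pdivlMr; last by lra.
  by have := cnorm_ge0 P (fun w => U w - U' w); nra.
by apply/funext => w; ring.
Qed.

Lemma csp0 S : csp P S (fun=> 0).
Proof. exact/sp_csp/sp0. Qed.

Lemma cspZ S c U : csp P S U -> csp P S (fun w => c * U w).
Proof.
by move=> /(csp_lin c)/(_ (csp0 S)); under eq_fun do rewrite addr0.
Qed.

Lemma cspB S U V : csp P S U -> csp P S V -> csp P S (fun w => U w - V w).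
Proof.
move=> hU hV; have := csp_lin (-1) hV hU.
by under eq_fun do rewrite mulN1r addrC.
Qed.

Lemma csp_sum S (I : Type) (r : seq I) (c : I -> C) (F : I -> T -> C) :
  (forall i, csp P S (F i)) ->
  csp P S (fun w => \sum_(i <- r) c i * F i w).
Proof.
move=> hF; elim: r => [|i r IHr].
  by under eq_fun do rewrite big_nil; exact: csp0.
by under eq_fun do rewrite big_cons; exact: csp_lin.
Qed.

(** [V - V'] lies in the closed span and is also the difference of the residuals [U - V'] and
    [U - V], so it is orthogonal to itself. *)
Lemma is_proj_unique S U V V' : L2_0 P U -> is_proj P S U V ->
  is_proj P S U V' -> {ae P, forall w, V w = V' w}.
Proof.
move=> hU [SV VO] [SV' VO']; have hV := csp_L2_0 SV; have hV' := csp_L2_0 SV'.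
have SD := cspB SV SV'; have hD := csp_L2_0 SD.
have hUV := L2_0B hU hV; have hUV' := L2_0B hU hV'.
have : {ae P, forall w, V w - V' w = 0}.
  apply: cinner_self_eq0 => //.
  rewrite [X in cinner P X _ = _](_ : _ =
    (fun w => (U w - V' w) - (U w - V w))); last by apply/funext => w; ring.
  by rewrite cinnerBl// VO// VO'// subrr.
by apply: filterS => w /eqP; rewrite subr_eq0 => /eqP.
Qed.

(** [Y j - Y' j] is a combination of the [Z i] and is orthogonal to each of them, hence to
    itself. *)
Lemma is_dual_unique (I : finType) (Z Y Y' : I -> T -> C) :
  (forall i, L2_0 P (Z i)) -> is_dual P Z Y -> is_dual P Z Y' ->
  forall j, {ae P, forall w, Y j w = Y' j w}.
Proof.
move=> hZ [spY YE] [spY' YE'] j.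
have [hY _] := spY j; have [hY' _] := spY' j.
have [hD [n [c [F [rF DE]]]]] := spB (spY j) (spY' j).
have : {ae P, forall w, Y j w - Y' j w = 0}.
  apply: cinner_self_eq0 => //.
  have hF i : L2_0 P (F i) by have [k _ <-] := rF i.
  rewrite (cinner_ae hD (L2_0_sum _ _ c hF) hD hD DE); last exact: aeW.
  rewrite cinner_suml// big1// => i _.
  by have [k _ <-] := rF i; rewrite cinnerBr// YE YE' subrr mulr0.
by apply: filterS => w /eqP; rewrite subr_eq0 => /eqP.
Qed.

End ClosedSpan.

(** * Innovations, the Wold decomposition and the finite expansion of prediction errors *)

Section Innovations.
Context (d : measure_display) (T : measurableType d) (R : realType).
Variables (P : probability T R) (X : int -> T -> R[i]).
Hypothesis X_L2 : forall j, L2_0 P (X j).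
Local Arguments cinner : simpl never.

Lemma past_sub i j : i <= j -> past X i `<=` past X j.
Proof.
by move=> ij _ [k ki <-]; exists k => //=; exact: lt_le_trans ij.
Qed.

Section NormalizedInnovations.
Variable eps : int -> T -> R[i].
Hypothesis eps_innov : normalized_innovations P X eps.

Lemma innovation_L2_0 j : L2_0 P (eps j).
Proof. by have [] := eps_innov j. Qed.

(** Writes the normalization as a left scalar factor, the form to which [L2_0Z], [cinnerZl] and
    [cspZ] apply. *)
Lemma innovationE j : exists PX,
  [/\ is_proj P (past X j) (X j) PX, 0 < cnorm P (fun w => X j w - PX w) &
    {ae P, forall w, eps j w =
      (real_complex R (cnorm P (fun w => X j w - PX w)))^-1 * (X j w - PX w)}].
Proof.
have [_ [PX [pPX PX0 epsE]]] := eps_innov j; exists PX; split=> //.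
by apply: filterS epsE => w ->; rewrite mulrC.
Qed.

Lemma innovation_orthogonal_past j W : csp P (past X j) W ->
  cinner P (eps j) W = 0.
Proof.
move=> SW; have heps := innovation_L2_0 j.
have [PX [[SPX PXO] _ epsE]] := innovationE j.
have hW := csp_L2_0 SW; have herr := L2_0B (X_L2 j) (csp_L2_0 SPX).
rewrite (cinner_ae heps (L2_0Z _ herr) hW hW epsE); last exact: aeW.
by rewrite cinnerZl// PXO// mulr0.
Qed.

(** Both [X i] and its projection on its own past belong to the closed past of [j]. *)
Lemma innovation_csp_past i j : i < j -> csp P (past X j) (eps i).
Proof.
move=> ij; have [PX [[SPX PXO] _ epsE]] := innovationE i.
have Serr : csp P (past X j) (fun w => X i w - PX w).
  apply: cspB; first by apply: csp_gen => //; exists i.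
  by apply: csp_sub SPX; apply: past_sub; exact: ltW.
apply: csp_ae (cspZ _ Serr) (innovation_L2_0 i) _.
by apply: filterS epsE => w ->.
Qed.

(** Of two distinct innovations the later is orthogonal to its past, which contains the earlier; the
    diagonal value is the normalization. *)
Lemma innovation_orthonormal i j : cinner P (eps i) (eps j) = (i == j)%:R.
Proof.
have hi := innovation_L2_0 i; have hj := innovation_L2_0 j.
case: ltgtP => [ij|ji|<-].
- rewrite cinner_conj// innovation_orthogonal_past ?conjc0//.
  exact: innovation_csp_past.
- exact/innovation_orthogonal_past/innovation_csp_past.
- have [PX [[SPX PXO] err0 epsE]] := innovationE i.
  have herr := L2_0B (X_L2 i) (csp_L2_0 SPX).
  have hZ := L2_0Z (real_complex R (cnorm P (fun w => X i w - PX w)))^-1 herr.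
  rewrite (cinner_ae hi hZ hi hZ epsE epsE) cinnerZl// cinnerZr//.
  rewrite -cnorm_sq// -fmorphV conjc_real -!rmorphM /=.
  by rewrite mulrA -invfM -expr2 mulVf ?rmorph1// expf_neq0// gt_eqF.
Qed.

End NormalizedInnovations.

(** Needed because [purely_nondeterministic] only asserts that some innovation sequence exists.
    Uniqueness of the projection makes residuals, and hence their norms, agree. *)
Lemma normalized_innovations_unique eps eps' :
  normalized_innovations P X eps -> normalized_innovations P X eps' ->
  forall j, {ae P, forall w, eps j w = eps' j w}.
Proof.
move=> hE hE' j; have [_ [V [SV _ epsE]]] := hE j.
have [_ [V' [SV' _ epsE']]] := hE' j.
have VV' := is_proj_unique (X_L2 j) SV SV'.
have [/csp_L2_0 hV _] := SV; have [/csp_L2_0 hV' _] := SV'.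
have errE : {ae P, forall w, X j w - V w = X j w - V' w}.
  by apply: filterS VV' => w ->.
rewrite (cnorm_ae (L2_0B (X_L2 j) hV) (L2_0B (X_L2 j) hV') errE) in epsE.
by apply: filterS3 errE epsE epsE' => w e -> ->; rewrite e.
Qed.

Lemma wold_decomposition eps : purely_nondeterministic P X ->
  normalized_innovations P X eps -> forall j : int,
  (fun N : nat => cnorm P (fun w =>
     X j w - \sum_(l < N) MA_coef P X eps l * eps (j - l%:Z) w))
  @ \oo --> (0 : R).
Proof.
move=> [eps' [hE' wold']] hE j.
have L2e := innovation_L2_0 hE; have L2e' := innovation_L2_0 hE'.
have ee' := normalized_innovations_unique hE hE'.
have MAE l : MA_coef P X eps l = MA_coef P X eps' l.
  by apply: cinner_ae => //; exact: aeW.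
rewrite (_ : (fun N => _) = (fun N : nat => cnorm P (fun w =>
     X j w - \sum_(l < N) MA_coef P X eps' l * eps' (j - l%:Z) w))).
  exact: wold'.
apply/funext => N; apply: cnorm_ae; [by apply: L2_0B => //; exact: L2_0_sum..|].
(* Countably many null sets are merged, one for each lag. *)
have := ae_foralln (fun l => ee' (j - l%:Z)).
apply: filterS => w eE; congr (_ - _); apply: eq_bigr => l _.
by rewrite MAE eE.
Qed.

(** The lags [l <= r] are those whose innovation sits at time [j - r] or later and is therefore
    orthogonal to the past of [j - r]; all further lags fall into that past. *)
Lemma prediction_error_innovations eps (j : int) (r : nat) (V : T -> R[i]) :
  purely_nondeterministic P X -> normalized_innovations P X eps ->
  is_proj P (past X (j - r%:Z)) (X j) V ->
  {ae P, forall w,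
    X j w - V w = \sum_(l < r.+1) MA_coef P X eps l * eps (j - l%:Z) w}.
Proof.
move=> pnd hE [SV VO]; have wold := wold_decomposition pnd hE j.
set c := MA_coef P X eps in wold *.
have L2e := innovation_L2_0 hE; have hV := csp_L2_0 SV.
pose Q w := \sum_(l < r.+1) c l * eps (j - l%:Z) w.
have hQ : L2_0 P Q by apply: L2_0_sum => l; exact: L2e.
have tail : csp P (past X (j - r%:Z)) (fun w => X j w - Q w).
  apply: csp_closed => [|e e0]; first exact: L2_0B.
  have /cvgrPdist_lt/(_ _ e0)[N _ NP] := wold.
  (* The Wold partial sum with [r.+1 + N] terms, stripped of its first [r.+1] terms, which form
     [Q]. *)
  exists (fun w => \sum_(l < N) c (r.+1 + l)%N * eps (j - (r.+1 + l)%N%:Z) w).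
  split.
    apply: csp_sum => l.
    by apply: innovation_csp_past => //; lia.
  have := NP (r.+1 + N)%N (leq_addl _ _).
  rewrite /= sub0r normrN ger0_norm ?cnorm_ge0//.
  congr (cnorm _ _ < _); apply/funext => w.
  by rewrite big_split_ord /= opprD addrA.
have : {ae P, forall w, X j w - V w - Q w = 0}.
  have hXV := L2_0B (X_L2 j) hV; have hD := L2_0B hXV hQ.
  apply: cinner_self_eq0 => //.
  have SD : csp P (past X (j - r%:Z)) (fun w => X j w - V w - Q w).
    rewrite (_ : (fun w => _) = (fun w => (X j w - Q w) - V w)).
      exact: cspB.
    by apply/funext => w; rewrite addrAC.
  rewrite cinnerBl// VO// cinner_suml// big1 ?subrr// => l _.
  rewrite (innovation_orthogonal_past hE) ?mulr0//.
  by apply: csp_sub SD; apply: past_sub; have := ltn_ord l; lia.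
by apply: filterS => w /eqP; rewrite subr_eq0 => /eqP.
Qed.

End Innovations.

(** * Lower triangular Toeplitz matrices *)

Section LowerToeplitz.
Variables (K : comNzRingType) (p : nat).
Implicit Types s t : nat -> K.

(** The guard matters: truncated subtraction would otherwise put [s 0] above the diagonal. *)
Definition lower_toeplitz s : 'M[K]_p :=
  \matrix_(i, k) if (k <= i)%N then s (i - k)%N else 0.

(** Only [j <= k <= i] contributes to the entry at [i], [j], and substituting [i - k] for [k] gives
    the Cauchy product coefficient of order [i - j]. *)
Lemma lower_toeplitzM s t : lower_toeplitz s *m lower_toeplitz t =
  lower_toeplitz (fun n => \sum_(k < n.+1) s k * t (n - k)%N).
Proof.
apply/matrixP => i j; rewrite !mxE.
under eq_bigr do rewrite !mxE.
rewrite (bigID (fun k : 'I_p => (j <= k)%N && (k <= i)%N)) /=.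
rewrite [X in _ + X]big1 ?addr0; last first.
  by move=> k; case: (j <= k)%N; case: (k <= i)%N; rewrite ?(mul0r, mulr0).
have [ji|ij] := leqP j i; last by rewrite big_pred0// => k; lia.
under eq_bigr => k /andP[jk ki] do rewrite jk ki.
rewrite -(big_mkord (fun k => (j <= k)%N && (k <= i)%N)
  (fun k => s (i - k)%N * t (k - j)%N)).
rewrite -(big_mkord xpredT (fun k => s k * t (i - j - k)%N)) [RHS]big_nat_rev /=.
transitivity (\sum_(j <= k < i.+1) s (i - k)%N * t (k - j)%N).
  by rewrite (big_nat_widenl j 0%N)//= (big_nat_widen 0%N i.+1 p).
rewrite -{1}[nat_of_ord j]add0n big_addn subSn//.
by apply: eq_big_nat => k ?; congr (s _ * t _); lia.
Qed.

Lemma lower_toeplitz1 : lower_toeplitz (fun n => (n == 0%N)%:R) = 1%:M.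
Proof.
apply/matrixP => i j; rewrite !mxE -val_eqE /= subn_eq0.
by case: (ltngtP i j).
Qed.

End LowerToeplitz.

(** * Covariance matrix, its inverse and the dual of the prediction errors *)

Theorem mainTheorem3 (d : measure_display) (T : measurableType d)
    (R : realType) (P : probability T R)
    (X eps hatX : int -> T -> R[i]) (b a : nat -> R[i]) (m n : nat)
    (X' : 'I_(m + n).+1 -> T -> R[i]) (G : 'M[R[i]]_((m + n).+1)) :
  weakly_stationary P X ->
  purely_nondeterministic P X ->
  normalized_innovations P X eps ->
  (forall k, b k = MA_coef P X eps k) ->
  AR_coef b a ->
  (forall j : int, - m%:Z <= j -> is_proj P (past X (- m%:Z)) (X j) (hatX j)) ->
  X' = pred_error m n X hatX ->
  G = covmx P X' ->
  let Yf := fun (j : 'I_(m + n).+1) (w : T) =>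
    \sum_(k < (m + n).+1 | (j <= k)%N) (a (k - j)%N)^*%C * eps (idx m k) w in
  [/\ forall i j : 'I_(m + n).+1,
        G i j = \sum_(k < (m + n).+1 | (k <= minn i j)%N)
                  b (i - k)%N * (b (j - k)%N)^*%C,
      G \in unitmx,
      forall i j : 'I_(m + n).+1,
        invmx G i j = \sum_(k < (m + n).+1 | (maxn i j <= k)%N)
                        (a (k - i)%N)^*%C * a (k - j)%N,
      is_dual P X' Yf &
      forall Y : 'I_(m + n).+1 -> T -> R[i], is_dual P X' Y ->
        forall j, {ae P, forall w, Y j w = Yf j w}].
Proof.
move=> [X_L2 _] pnd hE bE hAR hproj XE GE Yf.
pose conjT (A : 'M[R[i]]_((m + n).+1)) := (map_mx (@conjc R) A)^T.
pose e (k : 'I_(m + n).+1) := eps (idx m k).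
pose A : 'M[R[i]]_((m + n).+1) := lower_toeplitz _ a.
pose B : 'M[R[i]]_((m + n).+1) := lower_toeplitz _ b.
have e_L2 k : L2_0 P (e k) by exact: innovation_L2_0 hE _.
have e_orth i j : cinner P (e i) (e j) = (i == j)%:R.
  by rewrite (innovation_orthonormal X_L2 hE) (inj_eq (addIr _)).
have X'_L2 i : L2_0 P (X' i).
  rewrite XE; apply: L2_0B => //.
  by have [|/csp_L2_0] := hproj (idx m i); first by rewrite /idx; lia.
have lin_L2 (c : 'I_(m + n).+1 -> R[i]) : L2_0 P (fun w => \sum_k c k * e k w).
  exact: L2_0_sum.
have X'E i : {ae P, forall w, X' i w = \sum_k B i k * e k w}.
  (* The expansion is applied with [r = i]: going back [i] steps from [idx m i] reaches [-m]. *)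
  have jm : idx m i - (i : nat)%:Z = - m%:Z by rewrite /idx; lia.
  have := @prediction_error_innovations _ _ _ P X X_L2 eps (idx m i) i
    (hatX (idx m i)) pnd hE.
  rewrite jm => /(_ (hproj _ _)) XiE.
  have {}XiE := XiE ltac:(rewrite /idx; lia).
  rewrite XE; apply: filterS XiE => w; rewrite /pred_error => ->.
  rewrite [RHS](bigID (fun k : 'I__ => (k <= i)%N)) /=.
  rewrite [X in _ = _ + X]big1 ?addr0.
    (* Reversing the sum turns the lag [l] into the position [k = i - l]; the [i.+1] terms are then
       widened to all ordinals under the guard [k <= i]. *)
    rewrite -(big_mkord xpredT (fun l =>
      MA_coef P X eps l * eps (idx m i - l%:Z) w)) big_nat_rev /= big_mkord.
    rewrite (big_ord_widen _ (fun l : nat =>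
      MA_coef P X eps (0 + i.+1 - l.+1)%N *
      eps (idx m i - (0 + i.+1 - l.+1)%N%:Z) w) (ltn_ord i)).
    apply: eq_bigr => k ki; rewrite mxE -ltnS ki bE.
    by congr (MA_coef _ _ _ _ * eps _ _); rewrite /idx; lia.
  by move=> k /negbTE ki; rewrite mxE ki mul0r.
have YfE j w : Yf j w = \sum_k conjT A j k * e k w.
  rewrite /Yf [RHS](bigID (fun k : 'I__ => (j <= k)%N)) /=.
  rewrite [X in _ = _ + X]big1 ?addr0; last first.
    by move=> k /negbTE jk; rewrite !mxE jk conjc0 mul0r.
  by apply: eq_bigr => k jk; rewrite !mxE jk.
have BA1 : B *m A = 1%:M.
  rewrite lower_toeplitzM -lower_toeplitz1.
  by apply/matrixP => i j; rewrite !mxE hAR.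
(* For square matrices a one-sided inverse is two-sided. *)
have AB1 := mulmx1C BA1.
have conjTM C D : conjT (C *m D) = conjT D *m conjT C.
  by rewrite /conjT map_mxM trmx_mul.
have conjT1 : conjT 1%:M = 1%:M by rewrite /conjT map_mx1 trmx1.
have GBB : G = B *m conjT B.
  apply/matrixP => i j; rewrite GE !mxE.
  (* Orthonormality of [e] collapses the double sum to the terms [B i k] times the conjugate of
     [B j k]. *)
  rewrite (cinner_ae (X'_L2 i) (lin_L2 _) (X'_L2 j) (lin_L2 _) (X'E i) (X'E j)).
  rewrite cinner_suml//; apply: eq_bigr => k _; rewrite cinner_sumr//.
  rewrite (bigD1 k)//= big1 ?addr0; last first.
    by move=> l lk; rewrite e_orth eq_sym (negbTE lk) mulr0.
  by rewrite e_orth eqxx mulr1 !mxE.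
(* Regrouping the middle factors as [conjT (A *m B)], which is the identity, leaves [B *m A]. *)
have GA1 : G *m (conjT A *m A) = 1%:M.
  by rewrite GBB -mulmxA (mulmxA _ (conjT A)) -conjTM AB1 conjT1 mul1mx.
have [Gu _] := mulmx1_unit GA1.
have invG : invmx G = conjT A *m A.
  by rewrite -[LHS]mulmx1 -GA1 mulKmx.
have Yf_L2 j : L2_0 P (Yf j).
  by rewrite (_ : Yf j = fun w => \sum_k conjT A j k * e k w); last exact: funext.
have Yf_dual : is_dual P X' Yf.
  split=> [j|i j].
    (* The coefficients are row [j] of the inverse covariance matrix. *)
    split=> //; exists (m + n).+1, (fun i => invmx G j i), X'.
    split=> [i|]; first by exists i.
    (* The finitely many expansions must hold off one null set; the family is indexed by all
       naturals to fit [ae_foralln], vacuously beyond the index range. *)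
    have /ae_foralln X'all :
        forall k : nat, {ae P, forall w, forall i : 'I_(m + n).+1, i = k :> nat ->
          X' i w = \sum_k B i k * e k w}.
      move=> k; have [kp|pk] := ltnP k (m + n).+1.
        apply: filterS (X'E (Ordinal kp)) => w + i ik.
        by have -> : i = Ordinal kp by exact: val_inj.
      by apply: aeW => w i ik; have := ltn_ord i; rewrite ik ltnNge pk.
    apply: filterS X'all => w X'w; rewrite YfE.
    under [RHS]eq_bigr => i _ do rewrite (X'w i i erefl) mulr_sumr.
    rewrite exchange_big; apply: eq_bigr => k _ /=.
    under eq_bigr do rewrite mulrA.
    rewrite -mulr_suml; congr (_ * _).
    have -> : conjT A = invmx G *m B by rewrite invG -mulmxA AB1 mulmx1.
    by rewrite mxE.
  (* Conjugation in the second argument undoes that in [conjT A], so the inner product is the entry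
     of [B *m A]. *)
  rewrite (cinner_ae (X'_L2 i) (lin_L2 _) (Yf_L2 j) (lin_L2 _) (X'E i)
    (aeW _ (YfE j))).
  transitivity ((B *m A) i j); last by rewrite BA1 mxE.
  rewrite mxE cinner_suml//; apply: eq_bigr => k _; rewrite cinner_sumr//.
  rewrite (bigD1 k)//= big1 ?addr0; last first.
    by move=> l lk; rewrite e_orth eq_sym (negbTE lk) mulr0.
  by rewrite e_orth eqxx mulr1 !mxE conjcK.
split=> //.
- move=> i j; rewrite GBB mxE.
  (* Beyond the minimum one of the two triangular factors vanishes. *)
  rewrite (bigID (fun k : 'I__ => (k <= minn i j)%N)) /= [X in _ + X]big1 ?addr0.
    by apply: eq_bigr => k; rewrite leq_min !mxE => /andP[-> ->].
  move=> k; rewrite leq_min !mxE.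
  by case: (k <= i)%N; rewrite ?mul0r//=; case: (k <= j)%N; rewrite ?conjc0 ?mulr0.
- move=> i j; rewrite invG mxE.
  (* Below the maximum one of [A k i], [A k j] lies above the diagonal and is zero. *)
  rewrite (bigID (fun k : 'I__ => (maxn i j <= k)%N)) /= [X in _ + X]big1 ?addr0.
    by apply: eq_bigr => k; rewrite geq_max !mxE => /andP[-> ->].
  move=> k; rewrite geq_max !mxE.
  by case: (i <= k)%N; rewrite ?conjc0 ?mul0r//=; case: (j <= k)%N; rewrite ?mulr0.
- by move=> Y hY; apply: is_dual_unique X'_L2 hY Yf_dual.
Qed.
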